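(* Let $\kappa > \omega$ be a cardinal and $\mathscr{I}$ a normal ideal on $\kappa$. If for all $1 \leq n < \omega$ the poset $((\mathscr{I}^n)^+,\subset)$ has the $\kappa$-Knaster property, then $\kappa \rightarrow (\kappa,\alpha)^2$ for every $\alpha < \omega_1$.
   Context: A proper ideal $\mathscr{I}$ on $\kappa$ is normal if it contains every $\alpha<\kappa$ and for every $X\in\mathscr{I}^+$ and regressive $f: X\to\kappa$ there is $\alpha$ with $f^{-1}(\{\alpha\})\in\mathscr{I}^+$, where $\mathscr{J}^+$ is the complement of an ideal $\mathscr{J}$ in the power set. Ideals $\mathscr{I}^n$ on $[\kappa]^n$: identifying $[\kappa]^1$ with $\kappa$, $\mathscr{I}^1 = \mathscr{I}$, $\mathscr{I}^{n+1} = \{Y \subset [\kappa]^{n+1} : \{\alpha : (Y)_\alpha \in (\mathscr{I}^n)^+\}\in\mathscr{I}\}$ with $(Y)_\alpha = \{F\setminus\{\alpha\} : F \in Y,\ \min F = \alpha\}$. In $((\mathscr{I}^n)^+,\subset)$, two elements are compatible iff their intersection lies in $(\mathscr{I}^n)^+$; $\kappa$-Knaster means every $\kappa$-sequence has a subsequence of length $\kappa$ of pairwise compatible elements. $\kappa \rightarrow (\kappa,\alpha)^2$ means: for every $c : [\kappa]^2\to 2$ there is either $X\subset\kappa$ of order type $\kappa$ with $c$ constantly $0$ on $[X]^2$, or $X\subset\kappa$ of order type $\alpha$ with $c$ constantly $1$ on $[X]^2$. *)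

(* Defs.v *)
From mathcomp Require Import all_boot all_order finmap.
From mathcomp Require Import wochoice all_classical.
Import Order.TTheory.

Set Implicit Arguments.
Unset Strict Implicit.
Unset Printing Implicit Defensive.

Local Open Scope order_scope.
Local Open Scope classical_set_scope.

(* An ordinal is given by an orderType whose order is a well-order; such a type
   is a (von Neumann) cardinal when it is not equinumerous with any of its
   proper initial segments. *)
Definition is_ordinal d (A : orderType d) : Prop :=
  well_order (<=%O : rel A).

Definition initial_segment d (A : orderType d) (a : A) : set A :=
  [set x | x < a].

Definition is_cardinal d (K : orderType d) : Prop :=
  is_ordinal K /\ forall a : K, ~ (initial_segment a #= [set: K])%card.

Definition has_order_type d (K : orderType d) d' (A : orderType d')
    (X : set K) : Prop :=
  exists2 f : A -> K, {mono f : x y / x <= y} & range f = X.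
Arguments has_order_type {d K d'} A X.

Definition is_ideal T (I : set (set T)) : Prop :=
  [/\ I set0, (forall X Y, X `<=` Y -> I Y -> I X) & setU_closed I].

Definition proper_ideal T (I : set (set T)) : Prop :=
  is_ideal I /\ ~ I [set: T].

(* A function f : X -> K is represented by a total function restricted to X. *)
Definition regressive_on d (K : orderType d) (X : set K) (f : K -> K) : Prop :=
  forall x, X x -> f x < x.

Definition normal_ideal d (K : orderType d) (I : set (set K)) : Prop :=
  [/\ proper_ideal I,
      (forall a : K, I (initial_segment a)) &
      forall (X : set K) (f : K -> K), ~ I X -> regressive_on X f ->
        exists a : K, ~ I (X `&` f @^-1` [set a])].

Definition nsubsets (T : choiceType) (n : nat) : set {fset T} :=
  [set F | #|` F| = n].
Arguments nsubsets T n : clear implicits.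

Definition is_min d (K : orderType d) (F : {fset K}) (a : K) : Prop :=
  a \in F /\ forall b, b \in F -> a <= b.

Definition section_at d (K : orderType d) (Y : set {fset K}) (a : K) :
    set {fset K} :=
  [set (F `\ a)%fset | F in [set F | Y F /\ is_min F a]].

Definition positive (T : choiceType) (n : nat) (J : set (set {fset T})) :
    set (set {fset T}) :=
  [set Y | Y `<=` nsubsets T n /\ ~ J Y].

(* The value at n = 0 is a placeholder. At n = 1 the set Y of singletons is
   identified with the set of a such that [fset a] is in Y. *)
Fixpoint ideal_power d (K : orderType d) (I : set (set K)) (n : nat) :
    set (set {fset K}) :=
  match n with
  | 0 => set0
  | 1 => [set Y | Y `<=` nsubsets K 1 /\ I [set a | Y [fset a]%fset]]
  | (_.+1 as m).+1 =>
      [set Y | Y `<=` nsubsets K m.+1 /\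
               I [set a | positive m (ideal_power I m) (section_at Y a)]]
  end.

(* P is a family of sets ordered by inclusion; compatibility in P means that
   the intersection stays in P. *)
Definition compatible T (P : set (set T)) (Y Z : set T) : Prop :=
  P (Y `&` Z).

Definition knaster d (K : orderType d) T (P : set (set T)) : Prop :=
  forall p : K -> set T, (forall i, P (p i)) ->
    exists2 e : K -> K, {homo e : i j / i < j} &
      forall i j, i != j -> compatible P (p (e i)) (p (e j)).
Arguments knaster {d} K {T} P.

Definition pairs_of (T : choiceType) (X : set T) : set {fset T} :=
  [set F | nsubsets T 2 F /\ [set` F] `<=` X].

(* K -> (A, B)^2; colour 0 is false and colour 1 is true. Only the values of c
   on two-element sets matter. *)
Definition arrow2 d (K : orderType d) dA (A : orderType dA)
    dB (B : orderType dB) : Prop :=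
  forall c : {fset K} -> bool,
    (exists2 X : set K, has_order_type A X &
       forall F, pairs_of X F -> c F = false) \/
    (exists2 X : set K, has_order_type B X &
       forall F, pairs_of X F -> c F = true).
Arguments arrow2 {d} K {dA} A {dB} B.

(* Main.v *)
(* Suppose that no set of type K is 0-homogeneous, and call a set dual when its
   complement is in I. Normality turns every Y in I^n into a dual set none of
   whose finite subsets is in Y. The Knaster property gives, for every dual C,
   a dual S such that whenever E < F are finite, F is nonempty and included in
   S, and E `|` F is 1-homogeneous, some x in C between E and F can be inserted:
   otherwise the bad F form an I^n-positive Y, and pairwise compatibility of K
   many of its sections Y_x yields a 0-homogeneous set of type K. Define C_a for
   a in A by recursion, C_a being the intersection of the S obtained from the
   C_b with b < a. A 1-homogeneous copy of A is then built by enumerating A in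
   type omega and inserting its points one at a time, the image of a in C_a:
   the points already above a lie in the S associated with C_a. *)
Require Import Defs.
From mathcomp Require Import all_boot all_order finmap.
From mathcomp Require Import all_classical.
Import Order.TTheory.

Set Implicit Arguments.
Unset Strict Implicit.

Local Open Scope order_scope.
Local Open Scope classical_set_scope.

(** * Dual sets, well-orders and infinite cardinals *)

Definition dual T (I : set (set T)) : set (set T) := [set C | I (~` C)].

Lemma is_ordinal_wf d (A : orderType d) :
  is_ordinal A -> well_founded (fun x y : A => x < y).
Proof.
move=> wo x; apply: contrapT => nAx.
pose P := [pred y : A | `[< ~ Acc (fun x y : A => x < y) y >]].
have [|z [[/asboolP nAz zmin] _]] := wo P; first by exists x; apply/asboolP.
apply: nAz; constructor => y yz; apply: contrapT => nAy.
by move: (zmin y); rewrite leNgt yz => /(_ (introT (asboolP _) nAy)).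
Qed.

Lemma fset_has_min d (K : orderType d) (F : {fset K}) :
  F != fset0 -> exists a, is_min F a.
Proof.
elim/finSet_rect: F => F IH F0.
have [x xF] := fset0Pn _ F0.
have [Fx|Fx] := eqVneq (F `\ x)%fset fset0.
  exists x; split=> // b bF; have [->//|bx] := eqVneq b x.
  by move/fsetP/(_ b): Fx; rewrite in_fsetD1 bx bF.
have [|a [aF amin]] := IH (F `\ x)%fset _ Fx; first exact: fproperD1.
have aF' : a \in F by move: aF; rewrite !inE => /andP[].
have [ax|xa] := leP a x.
  exists a; split=> // b bF; have [->//|bx] := eqVneq b x.
  by apply: amin; rewrite in_fsetD1 bx.
exists x; split=> // b bF; have [->//|bx] := eqVneq b x.
by rewrite (le_trans (ltW xa))// amin// in_fsetD1 bx.
Qed.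

Lemma card_le_injective T U (A : set T) (B : set U) : B !=set0 ->
  (A #<= B)%card -> exists2 f : T -> U, set_fun A B f & set_inj A f.
Proof.
elim/Ppointed: U => U in B *; first by rewrite emptyE => -[].
by move=> _ /pcard_leP/injfunPex.
Qed.

Lemma cardinal_no_max d (K : orderType d) :
  is_cardinal K -> infinite_set [set: K] -> forall m : K, exists x, m < x.
Proof.
move=> [_ cardK] Kinf m; apply: contrapT => /forallNP/= mmax.
have ltm x : x != m -> x < m.
  by move=> xm; rewrite lt_neqAle xm leNgt; apply/negP.
have inf : infinite_set ([set: K] `\ m) by exact: infinite_setD.
have [g gm ginj] := card_le_injective (infinite_setN0 inf)
  ((infiniteP _).1 inf).
have {}ginj : injective g by move=> i j; apply: ginj; rewrite inE.
(* Shifting along [m, g 0, g 1, ...] injects [K] below a maximum [m]. *)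
pose g' n := if n is k.+1 then g k else m.
have g'inj : injective g'.
  move=> [|i] [|j]//= => [mg|mg|/ginj->//].
    by case: (gm j I) => _ [].
  by case: (gm i I) => _ [].
have /choice[s sP] : forall x, exists y,
    (forall n, x = g' n -> y = g' n.+1) /\ ((forall n, x <> g' n) -> y = x).
  move=> x; have [[n ->]|ng] := pselect (exists n, x = g' n).
    by exists (g' n.+1); split=> [k /g'inj->|/(_ n)].
  by exists x; split=> // n xg; case: ng; exists n.
have sm x : s x < m.
  apply/ltm/eqP; have [[n xg]|/forallNP ng] := pselect (exists n, x = g' n).
    by rewrite (proj1 (sP x) _ xg); case: (gm n I).
  by rewrite (proj2 (sP x) ng); exact: (ng 0%N).
have sinj : injective s.
  move=> x y.
  have [[n xg]|/forallNP nx] := pselect (exists n, x = g' n);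
  have [[k yg]|/forallNP ny] := pselect (exists n, y = g' n).
  - by rewrite (proj1 (sP x) _ xg) (proj1 (sP y) _ yg) xg yg => /g'inj[->].
  - by rewrite (proj1 (sP x) _ xg) (proj2 (sP y) ny) => /esym/ny.
  - by rewrite (proj2 (sP x) nx) (proj1 (sP y) _ yg) => /nx.
  - by rewrite (proj2 (sP x) nx) (proj2 (sP y) ny).
apply/(cardK m)/card_eqPle; split; first exact: subset_card_le.
rewrite -(card_le_eql (inj_card_eq (in2W sinj))).
by apply: subset_card_le => _ [x _ <-]; exact: sm.
Qed.

Definition below d (K : orderType d) (E F : {fset K}) : Prop :=
  forall x y, x \in E -> y \in F -> x < y.

(** * Normal ideals: diagonal intersections and completeness *)

Section NormalIdeal.
Context (d : Order.disp_t) (K : orderType d) (I : set (set K)).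
Context (hI : normal_ideal I).

Let ideal0 : I set0. Proof. by case: hI => -[[]]. Qed.
Let idealS X Y : X `<=` Y -> I Y -> I X.
Proof. by case: hI => -[[_ + _] _] _ _; apply. Qed.
Let idealU X Y : I X -> I Y -> I (X `|` Y).
Proof. by case: hI => -[[_ _ +] _] _ _; apply. Qed.
Let idealT : ~ I [set: K]. Proof. by case: hI => -[]. Qed.
Let ideal_seg a : I (initial_segment a).
Proof. by case: hI => _ + _; apply. Qed.

Lemma dualT : dual I [set: K]. Proof. by rewrite /dual/= setCT. Qed.

Lemma positive_setI_dual (B C : set K) : ~ I B -> dual I C -> ~ I (B `&` C).
Proof.
move=> nB IC IBC; apply: nB; apply: idealS (idealU IBC IC) => x Bx.
by have [Cx|nCx] := pselect (C x); [left|right].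
Qed.

Lemma dualI (B C : set K) : dual I B -> dual I C -> dual I (B `&` C).
Proof. by rewrite /dual/= setCI; apply: idealU. Qed.

Lemma dual_diagonal (C : K -> set K) : (forall a, dual I (C a)) ->
  dual I [set x | forall a, a < x -> C a x].
Proof.
move=> IC; rewrite /dual/=; apply: contrapT => nI.
pose X := ~` [set x | forall a, a < x -> C a x].
have /choice[f fP] : forall x, exists a, X x -> a < x /\ ~ C a x.
  move=> x; have [Xx|nXx] := pselect (X x); last by exists x.
  by move: (Xx) => /existsNP[a /not_implyP ?]; exists a.
case: hI => _ _ /(_ X f nI)[x /fP[]//|a]; apply.
by apply: idealS (IC a) => x /= [/fP[_ +] <-].
Qed.

Lemma positive_unbounded (B : set K) a : ~ I B -> exists2 b, B b & a <= b.
Proof.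
move=> nB; apply: contrapT => nb; apply/nB/(idealS _ (ideal_seg a)) => x Bx.
by rewrite /initial_segment/= ltNge; apply/negP => ax; apply: nb; exists x.
Qed.

Context (no_max : forall m : K, exists x, m < x).

(* If [h] were unbounded on the segment below [a], sending [x] to some [y < a]
   with [x <= h y] would be regressive on a positive set but have bounded
   fibres: this is the regularity of [K]. *)
Lemma bounded_on_initial_segment (a : K) (h : K -> K) :
  exists b, forall x, x < a -> h x < b.
Proof.
apply: contrapT => /forallNP unb.
have /choice[f fP] : forall x, exists y, y < a /\ x <= h y.
  move=> x; have /existsNP[y /not_implyP[ya /negP]] := unb x.
  by rewrite -leNgt => ?; exists y.
have nI : ~ I (~` initial_segment a).
  move=> IC; apply: idealT; apply: idealS (idealU (ideal_seg a) IC) => x _.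
  by rewrite setUv.
case: hI => _ _ /(_ _ f nI)[x /negP|b].
  by rewrite -leNgt => /(lt_le_trans _); apply; case: (fP x).
have [b' bb'] := no_max (h b).
apply; apply: idealS (ideal_seg b') => x [_ fxb].
rewrite /initial_segment/=; have [_] := fP x.
by rewrite fxb => /le_lt_trans; apply.
Qed.

Context (wf_lt : well_founded (fun x y : K => x < y)).

(** Well-founded recursion: each value is taken in [B] above all earlier ones. These are bounded by
    regularity, and a positive set is unbounded. *)
Lemma positive_enumeration (B : set K) : ~ I B ->
  exists2 h : K -> K, {homo h : x y / x < y} & forall x, B (h x).
Proof.
move=> nB.
(* [next] is made total: on an unbounded [s] it returns an arbitrary point of [B]. *)
have /choice[next nextP] : forall s : set K, exists b,
    B b /\ ((exists u, forall y, s y -> y < u) -> forall y, s y -> y < b).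
  move=> s; have [[u su]|nu] := pselect (exists u, forall y, s y -> y < u).
    have [b Bb ub] := positive_unbounded u nB.
    by exists b; split=> // _ y /su /lt_le_trans; apply.
  have [x _] : exists x : K, True.
    apply: contrapT => nx; apply: idealT; apply: idealS ideal0 => x.
    by case: nx; exists x.
  by have [b Bb _] := positive_unbounded x nB; exists b.
pose F (x : K) (rec : forall y : K, y < x -> K) :=
  next [set z | exists y (yx : y < x), z = rec y yx].
pose h := Fix wf_lt (fun _ => K) F.
have hE x : h x = next [set h y | y in initial_segment x].
  rewrite /h Fix_eq => [|{}x f g fg].
    by congr next; apply/seteqP; split=> z /= [y]; [case=> yx ->|move=> yx <-];
      exists y => //; exists yx.
  by congr (F x); apply/functional_extensionality_dep => y;
    apply/functional_extensionality_dep => yx.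
exists h => [x y xy|x]; last first.
  by rewrite hE; case: (nextP [set h y | y in initial_segment x]).
rewrite [h y]hE; have [_] := nextP [set h z | z in initial_segment y].
apply; last by exists x.
have [u uP] := bounded_on_initial_segment y h.
by exists u => _ [z /uP hz <-].
Qed.

Context (T : Type) (cT : countable [set: T]) (Kunc : ~ countable [set: K]).

(** Injecting [T] into an infinite initial segment, below [b], turns the intersection into a
    diagonal one: a point [x >= b] lies above every index. *)
Lemma dual_countable (C : T -> set K) : (forall t, dual I (C t)) ->
  dual I [set x | forall t, C t x].
Proof.
move=> IC.
(* If all initial segments were finite, any injective sequence would be cofinal, making [K] a
   countable union of finite sets. *)
have [b infb] : exists b : K, infinite_set (initial_segment b).
  apply: contrapT => /forallNP nb; apply: Kunc.
  have Kinf : infinite_set [set: K] by move=> /finite_set_countable.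
  have [g _ ginj] := card_le_injective (infinite_setN0 Kinf)
    ((infiniteP _).1 Kinf).
  have -> : [set: K] = \bigcup_n ((initial_segment (g n)) `|` [set g n]).
    apply/seteqP; split=> // x _; apply: contrapT => nx.
    apply/(nb x)/infiniteP; rewrite -(card_le_eql (inj_card_eq ginj)).
    apply: subset_card_le => _ [n _ <-]; rewrite /initial_segment/= ltNge.
    apply/negP; rewrite le_eqVlt => /predU1P[xg|xg]; apply: nx; exists n => //.
      by right.
    by left.
  apply: bigcup_countable => // n _; apply: finite_set_countable.
  by rewrite finite_setU; split; [exact: (contrapT (nb _))|exact: finite_set1].
have [g gb ginj] := card_le_injective (infinite_setN0 infb)
  (card_le_trans cT ((infiniteP _).1 infb)).
have {}ginj t t' : g t = g t' -> t = t' by apply: ginj; rewrite inE.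
(* An index [a] outside the range of [g] contributes all of [K]. *)
have /dual_diagonal ID : forall a, dual I [set x | forall t, g t = a -> C t x].
  move=> a; have [[t ta]|nt] := pselect (exists t, g t = a).
    apply: idealS (IC t) => x /= nC Ctx; apply: nC => t' t'a.
    by rewrite (ginj t' t)// t'a.
  by apply: idealS ideal0 => x /= nC; apply: nC => t ta; case: nt; exists t.
apply: idealS (idealU ID (ideal_seg b)) => x /= nC.
have [xb|bx] := ltP x b; first by right.
left=> /= D; apply: nC => t; apply: (D (g t)) => //.
by apply: lt_le_trans bx; exact: gb.
Qed.

(** * Null sets of the powers of the ideal *)

Lemma ideal_power0 n : ideal_power I n.+1 set0.
Proof.
elim: n => [|n IH]; split=> //=.
apply: idealS ideal0 => a [_]; apply; suff -> : section_at set0 a = set0 by [].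
by apply/seteqP; split=> // F [G []].
Qed.

(** Induction on the dimension. Apart from a null set of minima [a], the section at [a] is null and
    is avoided on a dual [C a]. In the diagonal intersection of the [C a], what remains of [F] above
    its minimum [a] lies in [C a]. *)
Lemma dual_ideal_power n (Y : set {fset K}) : ideal_power I n.+1 Y ->
  exists2 C, dual I C & forall F : {fset K}, [set` F] `<=` C -> ~ Y F.
Proof.
elim: n Y => [|n IH] Y /= [Ysize IY].
  exists (~` [set a | Y [fset a]%fset]); first by rewrite /dual/= setCK.
  move=> F FC YF; have := Ysize _ YF => /eqP/cardfs1P[a Fa].
  by apply: (FC a) => /=; rewrite -?Fa// Fa inE.
pose bad := [set a | positive n.+1 (ideal_power I n.+1) (section_at Y a)].
have /choice[C CP] : forall a, exists C, dual I C /\ (~ bad a ->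
    forall F : {fset K}, [set` F] `<=` C -> ~ section_at Y a F).
  move=> a; have [ba|nba] := pselect (bad a).
    by exists setT; split => //; exact: dualT.
  have [|C IC CY] := IH (section_at Y a); last by exists C.
  apply: contrapT => nI; apply: nba; split=> // _ [F [YF [aF _]] <-].
  by move: (Ysize _ YF); rewrite /nsubsets/= (cardfsD1 a) aF => -[].
exists (~` bad `&` [set x | forall a, a < x -> C a x]).
  apply: dualI; first by rewrite /dual/= setCK.
  by apply: dual_diagonal => a; case: (CP a).
move=> F FC YF.
have [|a [aF amin]] := @fset_has_min _ _ F.
  by rewrite -cardfs_gt0 (Ysize _ YF).
have [_ /(_ _ (F `\ a)%fset)] := CP a; apply.
- by case: (FC a aF).
- move=> x /=; rewrite !inE => /andP[xa xF]; have [_] := FC x xF; apply.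
  by rewrite lt_neqAle eq_sym xa amin.
- by exists F.
Qed.

(** There may be too many [E] for a plain intersection to be dual. Since [E] lies below [F], one
    diagonal intersection for each of the [m] elements of [E] suffices. *)
Lemma dual_ideal_power_family n m (D : {fset K} -> set {fset K}) :
  (forall E, ideal_power I n.+1 (D E)) ->
  exists2 C, dual I C & forall E F : {fset K}, #|` E| = m ->
    below E F -> [set` F] `<=` C -> ~ D E F.
Proof.
elim: m D => [|m IH] D ID.
  have [C IC CD] := dual_ideal_power (ID fset0); exists C => // E F.
  by move/cardfs0_eq=> ->  _; exact: CD.
have /choice[C CP] : forall e, exists C, dual I C /\ forall E F : {fset K},
    #|` E| = m -> below E F -> [set` F] `<=` C -> ~ D (e |` E)%fset F.
  move=> e; have [C IC CD] := IH (fun E => D (e |` E)%fset) (fun E => ID _).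
  by exists C.
exists [set x | forall a, a < x -> C a x].
  by apply: dual_diagonal => a; case: (CP a).
move=> E F Em EF FC DEF.
have /fset0Pn[e eE] : E != fset0 by rewrite -cardfs_gt0 Em.
have [_ /(_ (E `\ e)%fset F)] := CP e; rewrite fsetD1K//; apply => //.
- by move: Em; rewrite (cardfsD1 e) eE => -[].
- by move=> x y; rewrite !inE => /andP[_ xE]; exact: EF.
- by move=> x xF; apply: (FC x xF); exact: EF.
Qed.

End NormalIdeal.

(** * Inserting a point into a homogeneous finite set *)

Definition homogeneous d (K : orderType d) (c : {fset K} -> bool)
    (F : {fset K}) : Prop :=
  forall x y, x \in F -> y \in F -> x < y -> c [fset x; y]%fset = true.

Definition inserts d (K : orderType d) (c : {fset K} -> bool)
    (E F : {fset K}) (x : K) : Prop :=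
  [/\ below E [fset x]%fset, below [fset x]%fset F &
      homogeneous c (E `|` (x |` F))%fset].

Definition obstructed d (K : orderType d) (c : {fset K} -> bool) (C : set K)
    (E : {fset K}) : set {fset K} :=
  [set F | [/\ below E F, homogeneous c (E `|` F)%fset &
               forall x, C x -> ~ inserts c E F x]].

Section Insertion.
Context (d : Order.disp_t) (K : orderType d) (I : set (set K)).
Context (hI : normal_ideal I) (hK : is_cardinal K).
Context (Kunc : ~ countable [set: K]).
Context (hKnaster : forall n : nat, (1 <= n)%N ->
  knaster K (positive n (ideal_power I n))).
Context (c : {fset K} -> bool).
Context (no_zero : forall h : K -> K, {homo h : x y / x < y} ->
  exists i j, i < j /\ c [fset h i; h j]%fset = true).

Lemma obstructed_pairs (C : set K) (E : {fset K}) (h : K -> K) :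
  {homo h : x y / x < y} -> (forall i, C (h i)) ->
  ~ (forall i j, i < j -> exists F, [/\ below [fset h j]%fset F,
       obstructed c C E (h i |` F)%fset & obstructed c C E (h j |` F)%fset]).
Proof.
move=> hh Ch hF; have [i [j [ij cij]]] := no_zero hh.
have [F [jF [Ei homi _] [Ej homj]]] := hF i j ij.
have hij := hh _ _ ij.
move=> /(_ (h i) (Ch i)); apply; split.
- by move=> x y xE; rewrite inE => /eqP ->; apply: Ei => //; rewrite fset1U1.
- move=> x y; rewrite inE => /eqP ->; rewrite !inE => /predU1P[->//|yF].
  by apply: lt_trans hij _; apply: jF; rewrite ?inE.
move=> x y; rewrite !inE => xG yG xy.
(* Every pair other than [h i], [h j] lies in one of the two sets already known to be
   homogeneous. *)
have [xi|xi] := eqVneq x (h i); have [yj|yj] := eqVneq y (h j).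
- by rewrite xi yj.
- apply: homi => //; rewrite !inE; first by rewrite xi eqxx orbT.
  by move: yG; rewrite (negPf yj).
- apply: homj => //; rewrite !inE; last by rewrite yj eqxx orbT.
  by move: xG; rewrite (negPf xi).
- have [yi|yi] := eqVneq y (h i).
    have xj : x == h j = false by apply: lt_eqF; rewrite (lt_trans xy)// yi.
    apply: homi => //; rewrite !inE; last by rewrite yi eqxx orbT.
    by move: xG; rewrite xj.
  apply: homj => //; rewrite !inE; first by move: xG; rewrite (negPf xi).
  by move: yG; rewrite (negPf yi).
Qed.

Let wf_lt : well_founded (fun x y : K => x < y).
Proof. by apply: is_ordinal_wf; case: hK. Qed.

Let no_max : forall m : K, exists x, m < x.
Proof. by apply: cardinal_no_max => // /finite_set_countable. Qed.

(** Otherwise positively many points of [C] have a positive section (in dimension one: form an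
    obstructed singleton). Enumerate them increasingly; a common member of two sections serves as
    the [F] of [obstructed_pairs]. *)
Lemma obstructed_null (C : set K) (E : {fset K}) n : dual I C ->
  ideal_power I n.+1 (nsubsets K n.+1 `&` obstructed c C E).
Proof.
move=> IC; set D := _ `&` _.
have Dsize : D `<=` nsubsets K n.+1 by move=> F [].
case: n @D Dsize => [|n] D Dsize /=; split => //; apply: contrapT => nB.
  have [h hh hD] := positive_enumeration hI no_max wf_lt
    (positive_setI_dual hI nB IC).
  apply: (obstructed_pairs (C := C) (E := E) hh) => [i|i j ij].
    by case: (hD i).
  (* In dimension one nothing remains above the minimum, so the common [F] is empty. *)
  exists fset0; rewrite !fsetU0; split.
  - by move=> x y _; rewrite inE.
  - by case: (hD i) => -[].
  - by case: (hD j) => -[].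
have [h hh hD] := positive_enumeration hI no_max wf_lt
  (positive_setI_dual hI nB IC).
(* The sections have dimension [n.+1], one less than [D]; the Knaster property is applied there. *)
have [e eh ecomp] := hKnaster (isT : (1 <= n.+1)%N) (fun i => proj1 (hD i)).
have heh : {homo h \o e : x y / x < y} by move=> x y /eh /hh.
apply: (obstructed_pairs (C := C) (E := E) heh) => [i|i j ij].
  by case: (hD (e i)).
(* Compatible sections meet, because the empty set is null. *)
have [F []] : exists F,
    (section_at D (h (e i)) `&` section_at D (h (e j))) F.
  apply: contrapT => /forallNP nF; have [_] := ecomp i j (negbT (lt_eqF ij)).
  apply.
  suff -> : section_at D (h (e i)) `&` section_at D (h (e j)) = set0.
    exact: ideal_power0.
  by apply/seteqP; split=> // G /nF.
move=> [F1 [DF1 [iF1 mini] F1E]] [F2 [DF2 [jF2 minj] F2E]].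
exists F; split.
- move=> x y; rewrite inE => /eqP -> yF.
  move: yF; rewrite -F2E !inE => /andP[yj yF2].
  by rewrite lt_neqAle eq_sym yj minj.
- by rewrite -F1E fsetD1K//; case: DF1.
- by rewrite -F2E fsetD1K//; case: DF2.
Qed.

(** For fixed sizes of [E] and [F] a dual set avoids all obstructed [F]; there are only countably
    many pairs of sizes. [F] is nonempty because the powers start at dimension one, whence the shift
    [p.2.+1]. *)
Lemma insertion (C : set K) : dual I C -> exists2 S, dual I S &
  forall E F : {fset K}, F != fset0 -> below E F -> [set` F] `<=` S ->
    homogeneous c (E `|` F)%fset -> exists2 x, C x & inserts c E F x.
Proof.
move=> IC.
have /choice[S SP] : forall p : nat * nat, exists S, dual I S /\
    forall E F : {fset K}, #|` E| = p.1 -> below E F -> [set` F] `<=` S ->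
      ~ (nsubsets K p.2.+1 `&` obstructed c C E) F.
  move=> [m n]; have [S IS SD] := dual_ideal_power_family hI m
    (fun E => obstructed_null E n IC).
  by exists S.
exists [set x | forall p, S p x].
  by apply: dual_countable => // p; case: (SP p).
move=> E F F0 EF FS homEF; apply: contrapT => nx.
have Fn : (#|` F|.-1).+1 = #|` F| by rewrite prednK// cardfs_gt0.
have [_ /(_ E F)] := SP (#|` E|, #|` F|.-1); apply => //.
- by move=> x xF; exact: (FS x xF).
- by split; rewrite ?Fn//; split=> // x Cx xP; apply: nx; exists x.
Qed.

End Insertion.

(** * Building a homogeneous copy of a countable order *)

Lemma homogeneousS d (K : orderType d) (c : {fset K} -> bool)
    (E F : {fset K}) :
  {subset E <= F} -> homogeneous c F -> homogeneous c E.
Proof. by move=> EF homF x y /EF xF /EF yF; exact: homF. Qed.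

Lemma pair_ordered d (K : orderType d) (F : {fset K}) :
  nsubsets K 2 F -> exists x y, x < y /\ F = [fset x; y]%fset.
Proof.
rewrite /nsubsets/= => F2.
have /fset0Pn[x xF] : F != fset0 by rewrite -cardfs_gt0 F2.
have /eqP/cardfs1P[y Fxy] : #|` (F `\ x)%fset| = 1%N.
  by move: F2; rewrite (cardfsD1 x F) xF => -[].
have yx : y != x by have := fset11 y; rewrite -Fxy !inE => /andP[].
rewrite -(fsetD1K xF) Fxy; case: (ltgtP x y) yx => // [xy|yx] _.
  by exists x, y.
by exists y, x; split=> //; rewrite fsetUC.
Qed.

Section Embedding.
Context (d : Order.disp_t) (K : orderType d) (c : {fset K} -> bool).
Context (dA : Order.disp_t) (A : orderType dA) (C S : A -> set K) (top : K).
Context (CS : forall a b, b < a -> C a `<=` S b) (Stop : forall a, S a top).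
Context (insert : forall a (E F : {fset K}), F != fset0 -> below E F ->
  [set` F] `<=` S a -> homogeneous c (E `|` F)%fset ->
  exists2 x, C a x & inserts c E F x).

(* The auxiliary point [top] above the whole copy of [A] keeps the upper part of
   every insertion nonempty. *)
Definition approximation (s : {fset A}) (g : A -> K) : Prop :=
  [/\ {in s, forall a, C a (g a)}, {in s, forall a, g a < top},
      {in s &, {homo g : a b / a < b}} &
      homogeneous c (top |` [fset g a | a in s])%fset].

(** The image of [s] is cut at [a] into [E] below and [F] above, with [top] added to [F]. By [CS]
    the images of points above [a] lie in [S a], so [insert] supplies the image of [a]. *)
Lemma approximation_extend s g a : approximation s g ->
  exists g', [/\ approximation (a |` s)%fset g' & {in s, g' =1 g}].
Proof.
move=> [gC gtop gmono ghom].
have [as_|as_] := boolP (a \in s).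
  by exists g; split=> //; rewrite (fsetUidPr _ _ _)// fsub1set.
pose E := [fset g b | b in s & b < a]%fset.
pose F := (top |` [fset g b | b in s & a < b])%fset.
have EP b : b \in s -> b < a -> g b \in E.
  by move=> bs ba; apply/imfsetP; exists b; rewrite //= inE bs.
have FP b : b \in s -> a < b -> g b \in F.
  move=> bs ab; rewrite in_fset1U; apply/orP; right.
  by apply/imfsetP; exists b; rewrite //= inE bs.
have [||||x Cx [Ex xF xhom]] := @insert a E F.
- by apply/fset0Pn; exists top; rewrite fset1U1.
- move=> x y /imfsetP[b /=]; rewrite inE => /andP[bs ba] ->.
  rewrite in_fset1U => /predU1P[->|]; first exact: gtop.
  move=> /imfsetP[b' /=]; rewrite inE => /andP[b's ab'] ->.
  by apply: gmono => //; exact: lt_trans ab'.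
- move=> x /=; rewrite in_fset1U => /predU1P[->//|].
  move=> /imfsetP[b /=]; rewrite inE => /andP[bs ab] ->.
  by apply: CS ab _ _; exact: gC.
- apply: homogeneousS ghom => x; rewrite !in_fsetU !in_fset1.
  by case/or3P=> [|->//|] /imfsetP[b /=]; rewrite inE => /andP[bs _] ->;
    apply/orP; right; apply/imfsetP; exists b.
pose g' b := if b == a then x else g b.
have g's b : b \in s -> g' b = g b.
  by rewrite /g'; case: eqP as_ => // -> /negPf->.
have g'a : g' a = x by rewrite /g' eqxx.
exists g'; split=> //; split.
- by move=> b /fset1UP[->|bs]; rewrite ?g'a ?g's//; exact: gC.
- move=> b /fset1UP[->|bs]; rewrite ?g'a ?g's//; last exact: gtop.
  by apply: xF; rewrite ?fset11// fset1U1.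
- move=> b b' /fset1UP[->|bs] /fset1UP[->|b's] bb'.
  + by rewrite ltxx in bb'.
  + by rewrite g'a g's//; apply: xF; rewrite ?fset11//; exact: FP.
  + by rewrite g'a g's//; apply: Ex; rewrite ?fset11//; exact: EP.
  + by rewrite !g's//; exact: gmono.
apply: homogeneousS xhom => y; rewrite in_fset1U => /predU1P[->|].
  by rewrite !in_fsetU !in_fset1 eqxx !orbT.
move=> /imfsetP[b /=] /fset1UP[->|bs] ->.
  by rewrite g'a !in_fsetU !in_fset1 eqxx !orbT.
rewrite g's//; case: (ltgtP b a) => [ba|ab|ba].
- by rewrite in_fsetU EP.
- by rewrite in_fsetU in_fset1U FP ?orbT.
- by rewrite -ba bs in as_.
Qed.

(** Points of [A] are added in the order of their codes. Values never change once assigned, so the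
    union of the finite stages is the embedding. *)
Lemma approximation_limit : countable [set: A] ->
  exists2 f : A -> K, {homo f : a b / a < b} &
    forall a b, a < b -> c [fset f a; f b]%fset = true.
Proof.
move=> cA.
have nat0 : [set: nat] !=set0 by exists 0%N.
have [code _ codeI] := card_le_injective nat0 cA.
have {}codeI a b : code a = code b -> a = b by apply: codeI; rewrite inE.
(* [q] inverts [code], with [None] at the numbers that code no point; such stages add nothing. *)
have /choice[q qP] : forall n, exists o, forall a, code a = n -> o = Some a.
  move=> n; have [[a an]|na] := pselect (exists a, code a = n).
    by exists (Some a) => b; rewrite -an => /codeI->.
  by exists None => a an; case: na; exists a.
pose valid (p : {fset A} * (A -> K)) := approximation p.1 p.2.
have /choice[step stepP] : forall po : ({fset A} * (A -> K)) * option A,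
    exists p', valid po.1 -> [/\ valid p', {subset po.1.1 <= p'.1},
      {in po.1.1, p'.2 =1 po.1.2} & forall a, po.2 = Some a -> a \in p'.1].
  move=> [[s g] [a|]]; last by exists (s, g) => v; split.
  have [v|nv] := pselect (valid (s, g)); last by exists (s, g) => /nv.
  have [g' [v' gg']] := approximation_extend a v.
  exists ((a |` s)%fset, g') => _; split=> //= [b bs|_ [<-]].
    by rewrite fset1Ur.
  by rewrite fset1U1.
(* The initial domain is empty, so the constant [top] is only a default value. *)
pose st := fix st n :=
  if n is k.+1 then step (st k, q k) else (fset0, fun=> top).
have st_valid n : valid (st n).
  elim: n => [|n IH]; last by case: (stepP (st n, q n) IH).
  split=> // x y; rewrite !in_fsetU !in_fset1.
  move=> /orP[/eqP->|/imfsetP[]//] /orP[/eqP->|/imfsetP[]//].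
  by rewrite ltxx.
have st_mono m n : (m <= n)%N -> {subset (st m).1 <= (st n).1} /\
    {in (st m).1, (st n).2 =1 (st m).2}.
  elim: n => [|n IH]; first by rewrite leqn0 => /eqP->; split.
  rewrite leq_eqVlt ltnS => /predU1P[->|/IH[sub eqg]]; first by split.
  have [_ sub' eqg' _] := stepP (st n, q n) (st_valid n).
  split=> [a /sub /sub'//|a am]; rewrite /= eqg' ?eqg//; exact: sub.
have code_st a : a \in (st (code a).+1).1.
  have [_ _ _] := stepP (st (code a), q (code a)) (st_valid _).
  by apply; exact: qP.
pose f a := (st (code a).+1).2 a.
have fE a n : (code a < n)%N -> a \in (st n).1 /\ (st n).2 a = f a.
  by move=> /st_mono[sub eqg]; split; [exact: sub|exact: eqg].
have fP a b : a < b -> f a < f b /\ c [fset f a; f b]%fset = true.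
  (* The stage with code [k] adds its point to [st k.+1], so both points are present one step after
     the larger code. *)
  move=> ab; have [_ _ gm gh] := st_valid (maxn (code a) (code b)).+1.
  have [|ain <-] := fE a (maxn (code a) (code b)).+1.
    by rewrite ltnS leq_maxl.
  have [|bin <-] := fE b (maxn (code a) (code b)).+1.
    by rewrite ltnS leq_maxr.
  have lt_ab := gm _ _ ain bin ab; split=> //.
  by apply: gh => //; rewrite in_fset1U; apply/orP; right; apply/imfsetP;
    [exists a|exists b].
by exists f => a b /fP[].
Qed.

End Embedding.

(** * The dichotomy and the recursive choice of dual sets *)

Unset Implicit Arguments.

Theorem theorem4p14 (d : Order.disp_t) (K : orderType d)
    (hK : is_cardinal K) (hKomega : ~ countable [set: K])
    (I : set (set K)) (hI : normal_ideal I)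
    (hKnaster : forall n : nat, (1 <= n)%N ->
       knaster K (positive n (ideal_power I n))) :
  forall (dA : Order.disp_t) (A : orderType dA),
    is_ordinal A -> countable [set: A] -> arrow2 K K A.
Proof.
move=> dA A oA cA c.
have [[h hh h0]|nh] := pselect (exists2 h : K -> K, {homo h : x y / x < y} &
    forall i j, i < j -> c [fset h i; h j]%fset = false).
  left; exists (range h); first by exists h => //; exact: le_mono.
  move=> F [/pair_ordered[x [y [xy ->]]] FX].
  have [i _ ix] := FX x (fset21 _ _); have [j _ jy] := FX y (fset22 _ _).
  by rewrite -ix -jy; apply: h0; rewrite -(leW_mono (le_mono hh)) ix jy.
have no_zero (h : K -> K) : {homo h : x y / x < y} ->
    exists i j, i < j /\ c [fset h i; h j]%fset = true.
  move=> hh; apply: contrapT => nij; apply: nh; exists h => // i j ij.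
  by apply/negP => cij; apply: nij; exists i, j.
(* [S] is made total, with an arbitrary value when [C] is not dual, so that the recursion can
   precede the proof that its values are dual. *)
have /choice[S SP] : forall C : set K, exists S, dual I C -> dual I S /\
    forall E F : {fset K}, F != fset0 -> below E F -> [set` F] `<=` S ->
    homogeneous c (E `|` F)%fset -> exists2 x, C x & inserts c E F x.
  move=> C; have [IC|nC] := pselect (dual I C); last by exists C.
  by have [S IS SP] := insertion hI hK hKomega hKnaster no_zero IC; exists S.
pose G (a : A) (rec : forall b : A, b < a -> set K) :=
  [set x | forall b (ba : b < a), S (rec b ba) x].
pose C := Fix (is_ordinal_wf oA) (fun=> set K) G.
have CE a : C a = [set x | forall b, b < a -> S (C b) x].
  rewrite /C Fix_eq// => {}a f g fg.
  by congr (G a); apply/functional_extensionality_dep => b;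
    apply/functional_extensionality_dep => ba.
have IC a : dual I (C a).
  elim/(well_founded_ind (is_ordinal_wf oA)): a => a IH; rewrite CE.
  (* The intersection over [b < a] is read as one over all of the countable [A], with trivial terms
     for the other [b]. *)
  apply: (dual_countable hI cA hKomega) => b.
  have [ba|ab] := pselect (b < a).
    suff -> : (fun x => b < a -> S (C b) x) = S (C b) by case: (SP _ (IH b ba)).
    by apply/seteqP; split=> x // /(_ ba).
  suff -> : (fun x => b < a -> S (C b) x) = setT by exact: dualT hI.
  by apply/seteqP; split.
have /(dual_countable hI cA hKomega) IS : forall a, dual I (S (C a)).
  by move=> a; have [] := SP _ (IC a).
(* A dual set is nonempty since the ideal is proper. *)
have [top topP] : exists x, forall a, S (C a) x.
  apply: contrapT => /forallNP nx; have [[_ + _] _] := hI; apply.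
  move: IS; rewrite /dual/=; congr I; apply/seteqP; split=> // x _.
  exact: nx.
have CS a b : b < a -> C a `<=` S (C b) by move=> ba x; rewrite CE; apply.
have [f fmono fc] := @approximation_limit _ _ c _ A C (S \o C) top
  CS topP (fun a => proj2 (SP _ (IC a))) cA.
right; exists (range f); first by exists f => //; exact: le_mono.
move=> F [/pair_ordered[x [y [xy ->]]] FX].
have [a _ ax] := FX x (fset21 _ _); have [b _ b_y] := FX y (fset22 _ _).
by rewrite -ax -b_y; apply: fc; rewrite -(leW_mono (le_mono fmono)) ax b_y.
Qed.
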